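(* Let $G$ be a finite simple connected graph. Then (i) $M^{ev}(Sd(G)) = F(G) + 4M_1(G) + 8m(G)$; (ii) $M^{ev}(ESTo(G)) = M^{ev}(L(G)) + 8M_1(L(G)) + 33m(L(G)) + 18m(G) - 18\eta(L(G))$.
   Context: For a finite simple graph $K$: $V(K)$ and $E(K)$ are its vertex and edge sets, $m(K)=|E(K)|$, $d_K(x)$ is the degree of the vertex $x$, $N[x]$ is the closed neighbourhood of $x$ (that is, $x$ together with its neighbours), and $\eta(K)$ is the total number of triangles in $K$. For an edge $e=xy$ of $K$, the edge-vertex degree is $deg^{ev}_K(e)=|N[x]\cup N[y]|$; equivalently $deg^{ev}_K(e)=d_K(x)+d_K(y)-\eta_K(e)$, where $\eta_K(e)$ is the number of triangles of $K$ containing $e$. The $ev$-degree Zagreb index is $M^{ev}(K)=\sum_{e\in E(K)} deg^{ev}_K(e)^2$. The first Zagreb index is $M_1(K)=\sum_{x\in V(K)} d_K(x)^2$ and the forgotten index is $F(K)=\sum_{x\in V(K)} d_K(x)^3$. The line graph $L(G)$ has vertex set $E(G)$, two vertices being adjacent iff the corresponding edges of $G$ are adjacent (distinct and sharing an endpoint). If $E(G)=\emptyset$, all the quantities for $L(G)$ are $0$. The subdivision graph $Sd(G)$ has vertex set $V(G)\sqcup E(G)$, with $x\in V(G)$ adjacent to $y\in E(G)$ iff $y$ is incident to $x$ in $G$, and no other adjacencies. The edge-semitotal graph $ESTo(G)$ has vertex set $V(G)\sqcup E(G)$, where two elements of $E(G)$ are adjacent iff they are adjacent edges of $G$, an element $x\in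 V(G)$ is adjacent to $y\in E(G)$ iff $y$ is incident to $x$, and there are no other adjacencies. *)

(* Defs.v *)
From HB Require Import structures.
From mathcomp Require Import all_boot all_order all_algebra.

Set Implicit Arguments.
Unset Strict Implicit.
Unset Printing Implicit Defensive.

Record sgraph := SGraph {
  vertex :> finType;
  adj : rel vertex;
  adj_sym : symmetric adj;
  adj_irrefl : irreflexive adj }.

(* The graph on no vertices is connected in this sense. *)
Definition connected_graph (K : sgraph) : Prop :=
  forall x y : K, connect (@adj K) x y.

Definition edges (K : sgraph) : {set {set K}} :=
  [set e | [exists x : K, exists y : K, adj x y && (e == [set x; y])]].

Definition size_graph (K : sgraph) : nat := #|edges K|.

Definition deg (K : sgraph) (x : K) : nat := #|[set y | adj x y]|.

Definition closed_nbhd (K : sgraph) (x : K) : {set K} :=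
  x |: [set y | adj x y].

Definition triangles (K : sgraph) : {set {set K}} :=
  [set t : {set K} | (#|t| == 3) &&
     [forall x in t, forall y in t, (x != y) ==> adj x y]].

Definition num_triangles (K : sgraph) : nat := #|triangles K|.

(* For an edge e = [set x; y], the union is N[x] :|: N[y]. *)
Definition deg_ev (K : sgraph) (e : {set K}) : nat :=
  #|\bigcup_(x in e) closed_nbhd x|.

Definition zagreb_ev (K : sgraph) : nat :=
  \sum_(e in edges K) deg_ev e ^ 2.

Definition zagreb1 (K : sgraph) : nat := \sum_(x : K) deg x ^ 2.

Definition forgotten (K : sgraph) : nat := \sum_(x : K) deg x ^ 3.

Definition edge_type (G : sgraph) : finType := {e : {set G} | e \in edges G}.

Definition edge_adj (G : sgraph) : rel (edge_type G) :=
  fun e f => (e != f) && (val e :&: val f != set0).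

Lemma edge_adj_sym (G : sgraph) : symmetric (@edge_adj G).
Proof. by move=> e f; rewrite /edge_adj eq_sym setIC. Qed.

Lemma edge_adj_irrefl (G : sgraph) : irreflexive (@edge_adj G).
Proof. by move=> e; rewrite /edge_adj eqxx. Qed.

Definition line_graph (G : sgraph) : sgraph :=
  SGraph (@edge_adj_sym G) (@edge_adj_irrefl G).

Definition Sd_adj (G : sgraph) : rel (G + edge_type G)%type := fun u v =>
  match u, v with
  | inl x, inr e | inr e, inl x => x \in val e
  | _, _ => false
  end.

Lemma Sd_adj_sym (G : sgraph) : symmetric (@Sd_adj G).
Proof. by case=> [x|e] [y|f]. Qed.

Lemma Sd_adj_irrefl (G : sgraph) : irreflexive (@Sd_adj G).
Proof. by case. Qed.

Definition Sd (G : sgraph) : sgraph :=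
  SGraph (@Sd_adj_sym G) (@Sd_adj_irrefl G).

Definition ESTo_adj (G : sgraph) : rel (G + edge_type G)%type := fun u v =>
  match u, v with
  | inl x, inr e | inr e, inl x => x \in val e
  | inr e, inr f => edge_adj e f
  | inl _, inl _ => false
  end.

Lemma ESTo_adj_sym (G : sgraph) : symmetric (@ESTo_adj G).
Proof. by case=> [x|e] [y|f] //=; rewrite edge_adj_sym. Qed.

Lemma ESTo_adj_irrefl (G : sgraph) : irreflexive (@ESTo_adj G).
Proof. by case=> [x|e] //=; rewrite edge_adj_irrefl. Qed.

Definition ESTo (G : sgraph) : sgraph :=
  SGraph (@ESTo_adj_sym G) (@ESTo_adj_irrefl G).

(* Main.v *)
Require Import Defs.
From HB Require Import structures.
From mathcomp Require Import all_boot all_order all_algebra.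
From mathcomp Require Import zify ring.

(** Both identities come from writing a sum over the edges of a graph as half of
the corresponding sum over ordered pairs of adjacent vertices ([sum_arcs]),
and from computing the ev-degree of every edge.

In [Sd G] adjacent vertices have disjoint neighbourhoods and the vertex coming
from an edge of [G] has degree 2, so an edge [x e] has ev-degree [deg x + 2] ([deg_ev_Sd]).  A vertex
[x] lies on [deg x] edges of [G], hence the index is the sum over [x] of
[deg x * (deg x + 2) ^ 2], which expands to the formula by the handshake lemma.

In [ESTo G], write [L] for the line graph.  For an edge [x e] joining a vertex
to an edge of [G], the closed neighbourhood of [x] lies in that of [e], since
all edges through [x] are equal or adjacent to [e]; the ev-degree is therefore
[deg e + 3], with [deg e] taken in [L] ([deg_ev_ESTo_incident]).  For an edge
[e f] joining two edges of [G], the union of the neighbourhoods is the one in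
[L] together with the three endpoints of [e] and [f]
([deg_ev_ESTo_adjacent]).  Each [e] has two endpoints, so the index is
[2 * sum_e (deg e + 3) ^ 2 + sum_(ef) (deg_ev (ef) + 3) ^ 2].  Expanding the
squares leaves one term that is not in the formula, the sum of the ev-degrees
over the edges of [L].  It equals the first Zagreb index minus three times the
number of triangles ([sum_deg_ev]), because the ev-degree of an edge is the sum
of the degrees of its ends minus the number of triangles on it, and every
triangle has three edges. *)

Set Implicit Arguments.
Unset Strict Implicit.
Unset Printing Implicit Defensive.

(** * Edges, triangles and sums over ordered adjacent pairs *)

Lemma edgesP (K : sgraph) (e : {set K}) :
  reflect (exists x y : K, adj x y /\ e = [set x; y]) (e \in edges K).
Proof.
rewrite inE; apply: (iffP existsP) => [[x /existsP[y /andP[xy /eqP ->]]]|].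
  by exists x, y.
by move=> [x [y [xy ->]]]; exists x; apply/existsP; exists y; rewrite xy eqxx.
Qed.

Lemma adj_neq (K : sgraph) (x y : K) : adj x y -> x != y.
Proof. by apply: contraTneq => ->; rewrite adj_irrefl. Qed.

Lemma card_edge (K : sgraph) (e : {set K}) : e \in edges K -> #|e| = 2.
Proof. by move=> /edgesP[x [y [/adj_neq xy ->]]]; rewrite cards2 xy. Qed.

Lemma triangleP (K : sgraph) (t : {set K}) :
  reflect (#|t| = 3 /\ {in t &, forall x y, x != y -> adj x y})
          (t \in triangles K).
Proof.
rewrite inE; apply: (iffP andP) => [[/eqP t3 /forall_inP cl]|[t3 cl]].
  split=> // x y xt yt; apply/implyP; exact: (forall_inP (cl x xt)).
split; first exact/eqP.
by apply/forall_inP => x xt; apply/forall_inP => y yt; apply/implyP/cl.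
Qed.

(** The fibre of [(x, y) |-> [set x; y]] over an edge consists of its two
orientations, and loops do not occur. *)
Lemma sum_arcs (K : sgraph) (F : {set K} -> nat) :
  \sum_(x : K) \sum_(y | adj x y) F [set x; y] = 2 * \sum_(e in edges K) F e.
Proof.
rewrite pair_big_dep /=.
rewrite (partition_big (fun p : K * K => [set p.1; p.2]) (mem (edges K))) /=;
  last by move=> [x y] /= xy; apply/edgesP; exists x, y.
rewrite big_distrr /=; apply: eq_bigr => e /edgesP[a [b [ab ->]]].
rewrite (eq_bigr (fun=> F [set a; b])) => [|p /andP[_ /eqP ->] //].
rewrite (eq_bigl (mem [set (a, b); (b, a)])) => [|[x y] /=].
  by rewrite sum_nat_const cards2 xpair_eqE (negPf (adj_neq ab)).
rewrite !inE !xpair_eqE; apply/andP/orP => [[xy /eqP exy]|].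
  have := adj_neq xy; have := set22 x y; have := set21 x y.
  by rewrite exy !inE => /pred2P[]-> /pred2P[]->; rewrite ?eqxx //=; auto.
by case=> /andP[/eqP-> /eqP->]; rewrite ?ab 1?adj_sym ?ab ?eqxx // setUC eqxx.
Qed.

Lemma sum_deg_arcs (K : sgraph) (f : K -> nat) :
  \sum_(x : K) \sum_(y | adj x y) f x = \sum_(x : K) deg x * f x.
Proof.
apply: eq_bigr => x _; rewrite (eq_bigl (mem [set y | adj x y])) => [|y /=].
  by rewrite sum_nat_const.
by rewrite inE.
Qed.

Lemma handshake (K : sgraph) : \sum_(x : K) deg x = 2 * size_graph K.
Proof.
rewrite /size_graph -sum1_card -(sum_arcs (fun=> 1)) sum_deg_arcs.
by apply: eq_bigr => x _; rewrite muln1.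
Qed.

(** * Ev-degrees and triangles *)

Lemma deg_ev_pair (K : sgraph) (x y : K) :
  deg_ev [set x; y] = #|closed_nbhd x :|: closed_nbhd y|.
Proof. by rewrite /deg_ev bigcup_setU !big_set1. Qed.

(** A triangle on the edge [x y] is determined by its third vertex, which is a
common neighbour of [x] and [y]. *)
Lemma card_edge_triangles (K : sgraph) (x y : K) : adj x y ->
  #|[set t in triangles K | [set x; y] \subset t]|
    = #|[set z | adj x z] :&: [set z | adj y z]|.
Proof.
move=> xy; have nxy := adj_neq xy.
rewrite -(card_in_imset (f := fun z => z |: [set x; y])); last first.
  move=> z z'; rewrite !inE => /andP[/adj_neq xz /adj_neq yz] _ ezz.
  have := setU11 z [set x; y]; rewrite ezz !inE.
  by rewrite !(eq_sym z) (negPf xz) (negPf yz) !orbF eq_sym => /eqP.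
apply: eq_card => t; rewrite inE; apply/andP/imsetP.
  move=> [/triangleP[t3 cl] ext].
  have [xt yt] : x \in t /\ y \in t.
    by move: ext; rewrite subUset !sub1set => /andP.
  have : #|t :\: [set x; y]| == 1.
    by rewrite cardsD (setIidPr ext) t3 cards2 nxy.
  move=> /cards1P[z ez].
  have : z \in t :\: [set x; y] by rewrite ez set11.
  rewrite !inE negb_or => /andP[/andP[zx zy] zt].
  exists z; last first.
    by rewrite -ez setUC setDE setUIr setUCr setIT; apply/esym/setUidPr.
  by rewrite !inE !cl // eq_sym.
move=> [z /setIP[xz yz] ->]; rewrite !inE in xz yz.
split; last exact: subsetUr.
apply/triangleP; split.
  rewrite cardsU1 cards2 nxy !inE (eq_sym z) (negPf (adj_neq xz)).
  by rewrite (eq_sym z) (negPf (adj_neq yz)).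
move=> u v; rewrite !inE => /or3P[] /eqP-> /or3P[] /eqP->;
  by rewrite ?eqxx ?xy ?xz ?yz // adj_sym ?xy ?xz ?yz.
Qed.

(** Inclusion-exclusion on the open neighbourhoods: as [x] and [y] are adjacent,
each lies in the neighbourhood of the other, so that the unions of the open and
of the closed neighbourhoods coincide. *)
Lemma deg_ev_triangles (K : sgraph) (x y : K) : adj x y ->
  deg_ev [set x; y] + #|[set t in triangles K | [set x; y] \subset t]|
    = deg x + deg y.
Proof.
move=> xy; rewrite card_edge_triangles // deg_ev_pair /deg -[RHS]cardsUI.
congr (_ + _); apply: eq_card => z; rewrite !inE.
case: eqP => [->|_]; first by rewrite (adj_sym y) xy !orbT.
by case: (z =P y) => [->|_]; rewrite ?xy ?orbT.
Qed.

(** Double counting of the pairs formed by a triangle and one of its edges; the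
edges of [K] inside a triangle are all of its 2-element subsets. *)
Lemma sum_edge_triangles (K : sgraph) :
  \sum_(e in edges K) #|[set t in triangles K | e \subset t]|
    = 3 * num_triangles K.
Proof.
under eq_bigr => e _ do rewrite -sum1dep_card.
rewrite (exchange_big_dep (mem (triangles K))) /=; last by move=> e t _ /andP[].
rewrite mulnC /num_triangles -sum_nat_const; apply: eq_bigr => t tt.
have /triangleP[t3 cl] := tt.
rewrite sum1_card.
rewrite (_ : 3 = #|[set e : {set K} | e \subset t & #|e| == 2]|);
  last by rewrite cards_draws t3.
apply: eq_card => e; rewrite unfold_in /= tt [RHS]inE /=; apply/andP/andP.
  by move=> [/card_edge ->].
move=> [et /cards2P[x [y [xy ee]]]]; split=> //; apply/edgesP; exists x, y.
move: et; rewrite ee subUset !sub1set => /andP[xt yt]; split=> //.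
exact: cl.
Qed.

(** Summing [deg x + deg y] over ordered adjacent pairs counts [deg x] once for
each neighbour of [x] in either position, that is, twice the first Zagreb
index. *)
Lemma sum_deg_ev (K : sgraph) :
  \sum_(e in edges K) deg_ev e + 3 * num_triangles K = zagreb1 K.
Proof.
rewrite -sum_edge_triangles -big_split /=.
(* Both sides are doubled, so that the edge sum becomes one over ordered pairs. *)
apply/eqP; rewrite -(eqn_pmul2l (isT : 0 < 2)) -sum_arcs; apply/eqP.
under eq_bigr => x _ do under eq_bigr => y xy do rewrite deg_ev_triangles //.
under eq_bigr => x _ do rewrite big_split /=.
rewrite big_split /= [X in _ + X](exchange_big_dep predT) //=.
under [X in _ + X]eq_bigr => y _ do under eq_bigl => x do rewrite adj_sym.
by rewrite !sum_deg_arcs addnn -mul2n.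
Qed.

(** * Graphs on a disjoint union *)

(** The form shared by the subdivision and edge-semitotal graphs: [A] is
independent.  The edges inside [B] are left as a sum over ordered pairs, which
vanishes for the former and is a sum over the edges of the line graph, by
[sum_arcs], for the latter. *)
Lemma sum_edges_sum_graph (A B : finType) (R : rel (A + B)%type)
    (Rsym : symmetric R) (Rirr : irreflexive R) (K := SGraph Rsym Rirr)
    (F : {set K} -> nat) :
  (forall x x', R (inl x) (inl x') = false) ->
  2 * \sum_(e in edges K) F e
    = 2 * (\sum_x \sum_(b | R (inl x) (inr b)) F [set inl x; inr b])
      + \sum_b \sum_(c | R (inr b) (inr c)) F [set inr b; inr c].
Proof.
move=> RA; rewrite -sum_arcs big_sumType /=.
under eq_bigr => x _ do
  rewrite big_sumType /= (eq_bigl pred0) // big_pred0_eq add0n.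
under [X in _ + X]eq_bigr => b _ do rewrite big_sumType /=.
rewrite [X in _ + X]big_split /= addnA mul2n -addnn; congr (_ + _ + _).
rewrite [RHS](exchange_big_dep predT) //=.
by apply: eq_bigr => b _; apply: eq_big => [x|x _]; rewrite 1?Rsym 1?setUC.
Qed.

Lemma card_sum_set (A B : finType) (S : {set A + B}) :
  #|S| = #|[set a | inl a \in S]| + #|[set b | inr b \in S]|.
Proof.
by rewrite -sum1_card big_sumType /= !sum1_card; congr (_ + _);
  apply: eq_card => x; rewrite !inE.
Qed.

(** * Incidences between vertices and edges *)

(** The edges through [x] are the pairs [[set x; y]], one for each neighbour
[y]. *)
Lemma card_incident (G : sgraph) (x : G) :
  #|[set e : edge_type G | x \in val e]| = deg x.
Proof.
rewrite -(card_imset _ val_inj).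
rewrite /deg -(card_in_imset (f := fun y => [set x; y])); last first.
  move=> y z; rewrite !inE => xy xz /setP/(_ y).
  by rewrite !inE eqxx orbT eq_sym (negPf (adj_neq xy)) => /esym/eqP.
apply: eq_card => e; apply/imsetP/imsetP => [[f]|[y]].
  rewrite inE => + -> {e}; case/edgesP: (valP f) => a [b [ab ->]].
  case/set2P=> ->; first by exists b; rewrite ?inE.
  by exists a; rewrite ?inE 1?adj_sym // setUC.
rewrite inE => xy ->.
have xye : [set x; y] \in edges G by apply/edgesP; exists x, y.
by exists (exist (fun e => e \in edges G) _ xye : edge_type G);
  rewrite ?inE /= ?inE ?eqxx.
Qed.

Lemma sum_incidences (G : sgraph) (f : G -> nat) :
  \sum_x \sum_(e : edge_type G | x \in val e) f x = \sum_x deg x * f x.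
Proof.
apply: eq_bigr => x _; rewrite -card_incident -sum_nat_const.
by apply: eq_bigl => e; rewrite inE.
Qed.

Lemma sum_incidences_edge (G : sgraph) (f : edge_type G -> nat) :
  \sum_x \sum_(e : edge_type G | x \in val e) f e = 2 * \sum_e f e.
Proof.
rewrite (exchange_big_dep predT) //= big_distrr; apply: eq_bigr => e _ /=.
by rewrite sum_nat_const (card_edge (valP e)).
Qed.

(** * Ev-degrees in the derived graphs *)

(** The neighbourhood of [x] contributes the edges through [x], and that of [e]
the two ends of [e]; [x] and [e] themselves are already among these. *)
Lemma deg_ev_Sd (G : sgraph) (x : G) (e : edge_type G) : x \in val e ->
  deg_ev [set (inl x : Sd G); inr e] = deg x + 2.
Proof.
move=> xe; rewrite deg_ev_pair card_sum_set addnC -(card_incident x).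
rewrite -(card_edge (valP e)); congr (_ + _); apply: eq_card => z; rewrite !inE /=.
  by rewrite orbF; case: eqP => [[->]|_]; rewrite ?xe ?orbT ?orbF.
by rewrite orbF; case: eqP => [[->]|_] /=; rewrite ?xe.
Qed.

(** The neighbourhood of [x] is absorbed by that of [e]; the latter is the
closed neighbourhood in the line graph together with the two ends of [e]. *)
Lemma deg_ev_ESTo_incident (G : sgraph) (x : G) (e : edge_type G) :
  x \in val e ->
  deg_ev [set (inl x : ESTo G); inr e] = @deg (line_graph G) e + 3.
Proof.
move=> xe; rewrite deg_ev_pair card_sum_set addnC -[3]/(1 + 2) addnA.
rewrite -(card_edge (valP e)).
have -> : @deg (line_graph G) e + 1 = #|@closed_nbhd (line_graph G) e|.
  by rewrite /closed_nbhd cardsU1 inE adj_irrefl addnC.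
congr (_ + _); apply: eq_card => z; rewrite !inE /=.
  (* An edge z through x either is e or shares x with it. *)
  apply/idP/idP => [/orP[/= xz|//]|ez]; last by apply/orP; right.
  case: (e =P z) => [->|/eqP nez]; first by rewrite eqxx.
  rewrite /edge_adj nez orbC /=; apply/orP; left.
  by apply/set0Pn; exists x; rewrite inE xe.
by rewrite orbF; case: eqP => [[->]|_]; rewrite ?xe.
Qed.

(** Two distinct 2-element sets that meet have exactly one common element. *)
Lemma card_setU_adjacent_edges (G : sgraph) (e f : edge_type G) :
  edge_adj e f -> #|val e :|: val f| = 3.
Proof.
move=> /andP[nef]; rewrite -card_gt0 => ef.
have := cardsUI (val e) (val f); rewrite !(card_edge (valP _)).
suff : #|val e :&: val f| < 2 by lia.
rewrite -(card_edge (valP e)) proper_card // properEneq subsetIl andbT.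
apply: contra nef => /eqP/setIidPl sef.
rewrite -val_eqE eqEcard sef.
by rewrite !(card_edge (valP _)).
Qed.

Lemma deg_ev_ESTo_adjacent (G : sgraph) (e f : edge_type G) : edge_adj e f ->
  deg_ev [set (inr e : ESTo G); inr f]
    = deg_ev [set (e : line_graph G); f] + 3.
Proof.
move=> ef; rewrite !deg_ev_pair card_sum_set addnC.
rewrite -(card_setU_adjacent_edges ef).
by congr (_ + _); apply: eq_card => z; rewrite !inE.
Qed.

(** * The two Zagreb index identities *)

Lemma zagreb_ev_Sd (G : sgraph) :
  zagreb_ev (Sd G) = forgotten G + 4 * zagreb1 G + 8 * size_graph G.
Proof.
apply/eqP; rewrite -(eqn_pmul2l (isT : 0 < 2)) /zagreb_ev; apply/eqP.
rewrite sum_edges_sum_graph // [X in _ + X]big1 ?addn0 => [|b _]; last first.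
  exact: big_pred0_eq.
congr (2 * _).
under eq_bigr => x _ do under eq_bigr => e xe do rewrite deg_ev_Sd //.
rewrite sum_incidences -[8]/(4 * 2) -mulnA -handshake !big_distrr -!big_split /=.
by apply: eq_bigr => x _; ring.
Qed.

(** The triangle term is moved to the left so that the identity holds in [nat],
without truncated subtraction. *)
Lemma zagreb_ev_ESTo (G : sgraph) (L := line_graph G) :
  zagreb_ev (ESTo G) + 18 * num_triangles L
    = zagreb_ev L + 8 * zagreb1 L + 33 * size_graph L + 18 * size_graph G.
Proof.
have -> : zagreb_ev (ESTo G) = 2 * (\sum_(e : L) (deg e + 3) ^ 2)
    + \sum_(s in edges L) (deg_ev s + 3) ^ 2.
  apply/eqP; rewrite -(eqn_pmul2l (isT : 0 < 2)) /zagreb_ev; apply/eqP.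
  rewrite sum_edges_sum_graph // mulnDr -[X in _ = _ + X]sum_arcs.
  rewrite -sum_incidences_edge; congr (2 * _ + _).
    apply: eq_bigr => x _; apply: eq_bigr => e xe.
    by rewrite deg_ev_ESTo_incident.
  apply: eq_bigr => e _; apply: eq_bigr => f ef.
  by rewrite deg_ev_ESTo_adjacent.
have -> : \sum_(e : L) (deg e + 3) ^ 2
    = zagreb1 L + 6 * (2 * size_graph L) + 9 * size_graph G.
  have -> : size_graph G = \sum_(e : L) 1.
    by rewrite /size_graph sum1_card card_sig; apply: eq_card.
  rewrite -handshake !big_distrr -!big_split /=.
  by apply: eq_bigr => e _; ring.
have -> : \sum_(s in edges L) (deg_ev s + 3) ^ 2
    = zagreb_ev L + 6 * \sum_(s in edges L) deg_ev s + 9 * size_graph L.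
  rewrite /size_graph -sum1_card !big_distrr -!big_split /=.
  by apply: eq_bigr => s _; ring.
by rewrite -sum_deg_ev; lia.
Qed.

Theorem theorem2p1 (G : sgraph) (hG : connected_graph G) :
  (zagreb_ev (Sd G) = forgotten G + 4 * zagreb1 G + 8 * size_graph G)%N
  /\
  ((zagreb_ev (ESTo G))%:Z
   = (zagreb_ev (line_graph G))%:Z + 8 * (zagreb1 (line_graph G))%:Z
     + 33 * (size_graph (line_graph G))%:Z + 18 * (size_graph G)%:Z
     - 18 * (num_triangles (line_graph G))%:Z)%R.
Proof.
split; first exact: zagreb_ev_Sd.
by have := zagreb_ev_ESTo G; lia.
Qed.
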